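(* Let $(\mathcal{M},\varphi,\xi,\eta,g)$ be a 5-dimensional elliptic ($\sigma=1$) or hyperbolic ($\sigma=-1$) weakly para-cosymplectic manifold with para-K\''ahler leaves and let $(\xi,V_1,V_2,V_3,V_4)$ be an adopted frame defined on a neighborhood $\mathcal{U}_p$ of a point $p$. Then there are 1-forms $\tau_1,\tau_2,\omega$ and functions $\alpha_1,\alpha_2$ on $\mathcal{U}_p$ such that for every vector field $X$ $$\nabla_X\xi=-AX=-g(X,V_1)V_1-\sigma g(X,V_2)V_2,$$ $$\nabla_XV_1=\tau_1(X)V_1,\quad \tau_1(X)=\alpha_1 g(X,V_1),\qquad \nabla_XV_2=\tau_2(X)V_2,\quad \tau_2(X)=\alpha_2g(X,V_2),$$ $$\nabla_XV_3=g(X,V_1)\xi+\omega(X)V_2-\tau_1(X)V_3,\qquad \nabla_XV_4=\sigma g(X,V_2)\xi-\omega(X)V_1-\tau_2(X)V_4.$$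
   Context: All manifolds, tensor fields and functions are smooth. An almost para-contact metric structure on $\mathcal{M}$, $\dim\mathcal{M}=2n+1$, is a quadruple $(\varphi,\xi,\eta,g)$ ($\varphi$ a $(1,1)$-tensor field, $\xi$ a vector field, $\eta$ a 1-form, $g$ a pseudo-Riemannian metric) with $\varphi^2=Id-\eta\otimes\xi$, $\eta(\xi)=1$, $g(\varphi X,\varphi Y)=-g(X,Y)+\eta(X)\eta(Y)$, $\eta(X)=g(\xi,X)$. With $\varPhi(X,Y)=g(\varphi X,Y)$, the manifold is almost para-cosymplectic if $d\eta=0$ and $d\varPhi=0$; it is then weakly para-cosymplectic if $R(X,Y)\varphi Z=\varphi R(X,Y)Z$ for all $X,Y,Z$, where $R(X,Y)Z=\nabla_X\nabla_YZ-\nabla_Y\nabla_XZ-\nabla_{[X,Y]}Z$ and $\nabla$ is the Levi-Civita connection. Put $A=-\nabla\xi$, i.e. $AX=-\nabla_X\xi$. Each leaf of the foliation $\eta=0$ inherits an almost para-Hermitian structure $(P,H)$ by restricting $\varphi$ and $g$; the manifold has para-K\''ahler leaves if $P$ is parallel for the Levi-Civita connection of $H$ on every leaf, equivalently $(\nabla_X\varphi)Y=g(A\varphi X,Y)\xi-\eta(Y)A\varphi X$. For such weakly para-cosymplectic manifolds it is known that $A^2=0$ and $(\nabla_XA)Y=(\nabla_YA)X$. Elliptic/hyperbolic (dimension 5): near each point there are smooth nowhere zero vector fields $V_1,V_2$ (unique up to sign) with $\varphi V_1=-V_1$, $\varphi V_2=V_2$, $g(V_1,V_2)=0$ and $AX=\varepsilon\left(g(X,V_1)V_1+\sigma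 g(X,V_2)V_2\right)$, $\varepsilon=\pm1$, where $\sigma=1$ in the elliptic and $\sigma=-1$ in the hyperbolic case. Replacing $(\xi,\eta)$ by $(-\xi,-\eta)$ if necessary, it is always assumed that $\varepsilon=1$. An adopted frame is a local frame $(\xi,V_1,V_2,V_3,V_4)$ extending $(\xi,V_1,V_2)$ with $\varphi V_3=V_3$, $\varphi V_4=-V_4$ and such that the only non-zero coefficients of the metric are $g(\xi,\xi)=g(V_1,V_3)=g(V_2,V_4)=1$ (and the symmetric ones). *)

(* Defs.v *)
From HB Require Import structures.
From mathcomp Require Import all_boot all_order all_algebra.
From mathcomp Require Import all_classical all_reals all_analysis.
From mathcomp Require Import ring.

Set Implicit Arguments.
Unset Strict Implicit.
Unset Printing Implicit Defensive.
Import Order.TTheory GRing.Theory Num.Theory numFieldNormedType.Exports.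
Local Open Scope classical_set_scope.
Local Open Scope ring_scope.

Lemma near_eq_continuous (S T : topologicalType) (f g : S -> T) x :
  (\near x, f x = g x) -> {for x, continuous f} -> {for x, continuous g}.
Proof.
move=> fg; rewrite /prop_for /continuous_at (nbhs_singleton fg) => fx.
by apply: cvg_trans fx; apply: near_eq_cvg; apply: filterS fg => y ->.
Qed.

Section SmoothEuclidean.
Variables (R : realType) (m : nat).
Implicit Types (O : set 'rV[R]_m) (f g : 'rV[R]_m -> R^o).

Fixpoint Ck (k : nat) O f : Prop :=
  {in O, continuous f} /\
  if k is k'.+1 then
    forall i : 'I_m, {in O, forall x, derivable f x (delta_mx 0 i)} /\
      Ck k' O (fun x => 'D_(delta_mx 0 i) f x)
  else True.

Definition smooth_euclid O f := forall k, Ck k O f.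

Lemma Ck_cont k O f : Ck k O f -> {in O, continuous f}.
Proof. by case: k => [|k] []. Qed.

Lemma CkW k O f : Ck k.+1 O f -> Ck k O f.
Proof.
elim: k f => [|k IH] f [cf df]; split => // i.
by have [d1 d2] := df i; split => //; exact: IH.
Qed.

Lemma Ck_sub k O O' f : O' `<=` O -> Ck k O f -> Ck k O' f.
Proof.
move=> sO; have sI x : x \in O' -> x \in O by rewrite !inE; apply: sO.
elim: k f => [|k IH] f [cf df]; split => //; try by move=> x /sI/cf.
by move=> i; have [d1 d2] := df i; split; [move=> x /sI/d1|exact: IH].
Qed.

Lemma Ck_eq k O f g : open O -> {in O, f =1 g} -> Ck k O f -> Ck k O g.
Proof.
move=> oO; elim: k f g => [|k IH] f g fg [cf df];
  have nfg x : x \in O -> \forall y \near x, f y = g y;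
  try by (move=> xO; apply: filterS (open_nbhs_nbhs (conj oO (set_mem xO)));
          move=> y /mem_set/fg).
  by split=> // x xO; apply: near_eq_continuous (nfg x xO) (cf x xO).
split=> [x xO|]; first exact: near_eq_continuous (nfg x xO) (cf x xO).
move=> i; have [d1 d2] := df i; split.
  by move=> x xO; apply: near_eq_derivable (d1 x xO); apply: nfg.
by apply: IH d2 => x xO; apply: near_eq_derive; apply: nfg.
Qed.

Lemma CkD k O f g : open O -> Ck k O f -> Ck k O g -> Ck k O (f \+ g).
Proof.
move=> oO; elim: k f g => [|k IH] f g [cf df] [cg dg].
  by split=> // x xO; exact: continuousD (cf x xO) (cg x xO).
split=> [x xO|i]; first exact: continuousD (cf x xO) (cg x xO).
have [f1 f2] := df i; have [g1 g2] := dg i; split=> [x xO|].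
  by apply: derivableD; [exact: f1|exact: g1].
apply: Ck_eq oO _ (IH _ _ f2 g2) => x xO /=.
by rewrite deriveD//; [exact: f1|exact: g1].
Qed.

Lemma CkM k O f g : open O -> Ck k O f -> Ck k O g -> Ck k O (f \* g).
Proof.
move=> oO; elim: k f g => [|k IH] f g Cf Cg; have [cf df] := Cf;
  have [cg dg] := Cg.
  by split=> // x xO; exact: continuousM (cf x xO) (cg x xO).
split=> [x xO|i]; first exact: continuousM (cf x xO) (cg x xO).
have [f1 f2] := df i; have [g1 g2] := dg i; split=> [x xO|].
  by apply: derivableM; [exact: f1|exact: g1].
apply: Ck_eq oO _ (CkD oO (IH _ _ (CkW Cf) g2) (IH _ _ (CkW Cg) f2)) => x xO /=.
by rewrite deriveM//; [exact: f1|exact: g1].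
Qed.

Lemma Ck_cst k O (a : R) : open O -> Ck k O (fun=> a).
Proof.
move=> oO; elim: k a => [|k IH] a; first by split=> // x _; exact: cst_continuous.
split=> [x _|i]; first exact: cst_continuous.
split=> [x _|]; first exact: derivable_cst.
by apply: Ck_eq oO _ (IH 0) => x _; rewrite derive_cst.
Qed.
End SmoothEuclidean.

Record chart (R : realType) (m : nat) (T : topologicalType) := Chart {
  chart_dom : set T;
  chart_cod : set 'rV[R]_m;
  chart_map : T -> 'rV[R]_m;
  chart_inv : 'rV[R]_m -> T;
  chart_dom_open : open chart_dom;
  chart_cod_open : open chart_cod;
  chart_map_cod : {homo chart_map : p / chart_dom p >-> chart_cod p};
  chart_inv_dom : {homo chart_inv : x / chart_cod x >-> chart_dom x};
  chart_mapK : {in chart_dom, cancel chart_map chart_inv};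
  chart_invK : {in chart_cod, cancel chart_inv chart_map};
  chart_map_continuous : {in chart_dom, continuous chart_map};
  chart_inv_continuous : {in chart_cod, continuous chart_inv} }.

Record smoothManifold (R : realType) (m : nat) := SmoothManifold {
  manifold_sort :> topologicalType;
  manifold_hausdorff : hausdorff_space manifold_sort;
  manifold_second_countable : @second_countable manifold_sort;
  atlas : set (chart R m manifold_sort);
  atlas_cover : forall p, exists2 c, atlas c & chart_dom c p;
  atlas_compatible : forall c c', atlas c -> atlas c' -> forall i : 'I_m,
    smooth_euclid (chart_cod c' `&` chart_inv c' @^-1` chart_dom c)
      (fun x => chart_map c (chart_inv c' x) 0 i) }.

Section TangentSpace.
Variables (R : realType) (m : nat) (M : smoothManifold R m).
Implicit Types (U W : set M) (p q : M) (f g : M -> R).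

Definition smooth_on U f := forall c, atlas c ->
  smooth_euclid (chart_cod c `&` chart_inv c @^-1` U) (f \o chart_inv c).

Definition smooth_at p f := exists U, [/\ open U, U p & smooth_on U f].

(* Derivations of the algebra of germs at p of smooth functions, encoded as
   functionals on all functions: they only depend on germs, and are given the
   value 0 on functions that are not smooth near p, so that two tangent vectors
   are equal as soon as they agree on smooth germs. *)
Definition is_derivation_at p (D : (M -> R) -> R^o) :=
  [/\ forall (a : R) f g, smooth_at p f -> smooth_at p g ->
        D (fun q => a * f q + g q) = a * D f + D g,
      forall f g, smooth_at p f -> smooth_at p g ->
        D (fun q => f q * g q) = f p * D g + g p * D f,
      forall f g, smooth_at p f -> smooth_at p g ->
        (\forall q \near p, f q = g q) -> D f = D g
    & forall f, ~ smooth_at p f -> D f = 0].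

Definition derivations_at p : {pred (M -> R) -> R^o} :=
  fun D => `[< is_derivation_at p D >].

Lemma derivations_at_submod p : submod_closed (derivations_at p).
Proof.
split=> [|a D E /asboolP[D1 D2 D3 D4] /asboolP[E1 E2 E3 E4]]; apply/asboolP.
  by split=> // [a f g _ _|f g _ _]; rewrite /= /GRing.zero/= !mulr0 addr0.
have aE f : (a *: D + E) f = a * D f + E f by [].
split=> [b f g fp gp|f g fp gp|f g fp gp fg|f fp]; rewrite !aE.
- by rewrite D1// E1//; ring.
- by rewrite D2// E2//; ring.
- by rewrite (D3 f g)// (E3 f g).
- by rewrite D4// E4// mulr0 addr0.
Qed.

HB.instance Definition _ p := GRing.isSubmodClosed.Build R ((M -> R) -> R^o)
  (derivations_at p) (derivations_at_submod p).

Record tangent p := Tangent {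
  tangent_val :> (M -> R) -> R^o;
  tangent_valP : tangent_val \in derivations_at p }.

HB.instance Definition _ p := [isSub for @tangent_val p].
HB.instance Definition _ p := [Choice of tangent p by <:].
HB.instance Definition _ p := [SubChoice_isSubLmodule of tangent p by <:].


Lemma smooth_onS U W f : W `<=` U -> smooth_on U f -> smooth_on W f.
Proof. by move=> WU sf c ac k; apply: Ck_sub (sf c ac k) => x [? /WU]. Qed.

Lemma chart_preimage_open (c : chart R m M) U : open U ->
  open (chart_cod c `&` chart_inv c @^-1` U).
Proof.
move=> oU; rewrite openE => x [cx Ux]; apply: (@filterI _ (nbhs x)).
  by apply: open_nbhs_nbhs; split=> //; exact: chart_cod_open.
have cinv := chart_inv_continuous (mem_set cx).
by apply: (cinv U); exact: open_nbhs_nbhs.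
Qed.

Lemma smooth_onD U f g : open U -> smooth_on U f -> smooth_on U g ->
  smooth_on U (fun q => f q + g q).
Proof.
move=> oU sf sg c ac k.
exact: CkD (chart_preimage_open oU) (sf c ac k) (sg c ac k).
Qed.

Lemma smooth_onM U f g : open U -> smooth_on U f -> smooth_on U g ->
  smooth_on U (fun q => f q * g q).
Proof.
move=> oU sf sg c ac k.
exact: CkM (chart_preimage_open oU) (sf c ac k) (sg c ac k).
Qed.

Lemma smooth_on_cst U (a : R) : open U -> smooth_on U (fun=> a).
Proof. by move=> oU c ac k; exact: Ck_cst (chart_preimage_open oU). Qed.

Lemma smooth_atD p f g : smooth_at p f -> smooth_at p g ->
  smooth_at p (fun q => f q + g q).
Proof.
move=> [U [oU Up sf]] [W [oW Wp sg]]; exists (U `&` W); split=> //.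
  exact: openI.
by apply: smooth_onD;
  [exact: openI|apply: smooth_onS sf|apply: smooth_onS sg] => // q [].
Qed.

Lemma smooth_atM p f g : smooth_at p f -> smooth_at p g ->
  smooth_at p (fun q => f q * g q).
Proof.
move=> [U [oU Up sf]] [W [oW Wp sg]]; exists (U `&` W); split=> //.
  exact: openI.
by apply: smooth_onM;
  [exact: openI|apply: smooth_onS sf|apply: smooth_onS sg] => // q [].
Qed.

Lemma smooth_at_cst p (a : R) : smooth_at p (fun=> a).
Proof. by exists setT; split=> //; [exact: openT|exact/smooth_on_cst/openT]. Qed.

Lemma smooth_at_near p f : smooth_at p f -> \forall q \near p, smooth_at q f.
Proof.
move=> [U [oU Up sf]]; apply: filterS (open_nbhs_nbhs (conj oU Up)) => q Uq.
by exists U.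
Qed.

Definition vector_field := forall p, tangent p.

Implicit Types (X Y Z : vector_field).

Definition smooth_vf U X := forall W f, open W -> W `<=` U -> smooth_on W f ->
  smooth_on W (fun q => X q f).

(* The Lie bracket at p of two vector fields that are smooth near p (see
   lie_bracketE for the existence of the tangent vector in question). *)
Definition lie_bracket X Y : vector_field := fun p =>
  xget 0 [set v : tangent p | forall f, smooth_at p f ->
            v f = X p (fun q => Y q f) - Y p (fun q => X q f)].

Lemma smooth_vf_at U X p f : open U -> U p -> smooth_vf U X ->
  smooth_at p f -> smooth_at p (fun q => X q f).
Proof.
move=> oU Up sX [W [oW Wp sf]]; exists (U `&` W).
have oUW : open (U `&` W) by exact: openI.
by split=> //; apply: sX => //; apply: smooth_onS sf => q [].
Qed.

Lemma lie_bracketE U X Y p f : open U -> U p -> smooth_vf U X ->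
  smooth_vf U Y -> smooth_at p f ->
  lie_bracket X Y p f = X p (fun q => Y q f) - Y p (fun q => X q f).
Proof.
move=> oU Up sX sY; rewrite /lie_bracket; case: xgetP => [v _|] /=.
  by move=> + fp; exact.
set B := fun f : M -> R =>
  if `[< smooth_at p f >] then X p (fun q => Y q f) - Y p (fun q => X q f)
  else 0 : R^o.
suff BP : B \in derivations_at p.
  move=> /(_ (Tangent BP)); case=> h hp; rewrite /= /B.
  by case: asboolP.
have XD Z : smooth_vf U Z -> forall (a : R) h k, smooth_at p h ->
    smooth_at p k ->
    \forall q \near p, Z q (fun r => a * h r + k r) = a * Z q h + Z q k.
  move=> sZ a h k /smooth_at_near hp /smooth_at_near kp.
  apply: filterS2 hp kp => q hq kq.
  by have /asboolP[+ _ _ _] := tangent_valP (Z q); exact.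
have XM Z : smooth_vf U Z -> forall h k, smooth_at p h ->
    smooth_at p k ->
    \forall q \near p, Z q (fun r => h r * k r) = h q * Z q k + k q * Z q h.
  move=> sZ h k /smooth_at_near hp /smooth_at_near kp.
  apply: filterS2 hp kp => q hq kq.
  by have /asboolP[_ + _ _] := tangent_valP (Z q); exact.
have XE Z : smooth_vf U Z -> forall h k, smooth_at p h ->
    smooth_at p k -> (\forall q \near p, h q = k q) ->
    \forall q \near p, Z q h = Z q k.
  move=> sZ h k /smooth_at_near hp /smooth_at_near kp /near_join hk.
  apply: filterS3 hp kp hk => q hq kq hkq.
  by have /asboolP[_ _ + _] := tangent_valP (Z q); exact.
have sm Z : smooth_vf U Z -> forall h, smooth_at p h ->
    smooth_at p (fun q => Z q h).
  by move=> sZ h; exact: smooth_vf_at Up sZ.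
have sD (a : R) h k : smooth_at p h -> smooth_at p k ->
    smooth_at p (fun q => a * h q + k q).
  by move=> hp kp; apply: smooth_atD => //; apply: smooth_atM => //;
    exact: smooth_at_cst.
have /asboolP[X1 X2 X3 _] := tangent_valP (X p).
have /asboolP[Y1 Y2 Y3 _] := tangent_valP (Y p).
have BE h : smooth_at p h ->
    B h = (X p (fun q => Y q h) : R) - (Y p (fun q => X q h) : R).
  by rewrite /B => hp; case: asboolP.
apply/asboolP; split=> [a h k hp kp|h k hp kp|h k hp kp hk|h hp].
- rewrite !BE//; last exact: sD.
  rewrite (X3 _ _ _ _ (XD Y sY a h k hp kp)); last 2 first.
  + by apply: sm => //; exact: sD.
  + by apply: sD; exact: sm.
  rewrite (Y3 _ _ _ _ (XD X sX a h k hp kp)); last 2 first.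
  + by apply: sm => //; exact: sD.
  + by apply: sD; exact: sm.
  by rewrite X1 ?Y1; [ring|exact: sm..].
- have hk := smooth_atM hp kp.
  have sMD Z : smooth_vf U Z ->
      smooth_at p (fun q => h q * Z q k + k q * Z q h).
    by move=> sZ; apply: smooth_atD; apply: smooth_atM => //; exact: sm.
  rewrite !BE//.
  rewrite (X3 _ _ _ _ (XM Y sY h k hp kp)); [|exact: sm|exact: sMD].
  rewrite (Y3 _ _ _ _ (XM X sX h k hp kp)); [|exact: sm|exact: sMD].
  have addE (v : tangent p) h' k' : smooth_at p h' -> smooth_at p k' ->
      v (fun q => h' q + k' q) = v h' + v k'.
    have /asboolP[v1 _ v3 _] := tangent_valP v.
    move=> h'p k'p; rewrite -[v h']mul1r -v1//; congr (v _).
    by apply/funext => q; rewrite mul1r.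
  rewrite !addE ?X2 ?Y2//; [ring|..];
    by [exact: sm|apply: smooth_atM => //; exact: sm].
- by rewrite !BE// (X3 _ _ _ _ (XE Y sY _ _ hp kp hk))
    ?(Y3 _ _ _ _ (XE X sX _ _ hp kp hk))//; exact: sm.
- by rewrite /B; case: asboolP.
Qed.

End TangentSpace.

Section TensorFields.
Variables (R : realType) (m : nat) (M : smoothManifold R m).
Implicit Types (U W : set M) (p q : M) (X Y Z : vector_field M).

(* Fields are total functions on M; a field "on an open set U" is only
   constrained on U. *)
Definition smooth_1form U (tau : forall p, tangent p -> R) :=
  (forall p, U p -> scalar (tau p)) /\
  (forall W X, open W -> W `<=` U -> smooth_vf W X ->
     smooth_on W (fun q => tau q (X q))).

Definition smooth_endo (phi : forall p, tangent p -> tangent p) :=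
  (forall p, linear (phi p)) /\
  (forall U X, open U -> smooth_vf U X -> smooth_vf U (fun q => phi q (X q))).

Record pseudo_riemannian (g : forall p, tangent p -> tangent p -> R) := {
  metric_sym : forall p (v w : tangent p), g p v w = g p w v;
  metric_linear : forall p (w : tangent p), scalar (fun v => g p v w);
  metric_nondegenerate : forall p (v : tangent p),
    (forall w, g p v w = 0) -> v = 0;
  metric_smooth : forall U X Y, open U -> smooth_vf U X -> smooth_vf U Y ->
    smooth_on U (fun q => g q (X q) (Y q)) }.

Definition extd1 (eta : forall p, tangent p -> R) X Y p : R :=
  X p (fun q => eta q (Y q)) - Y p (fun q => eta q (X q))
  - eta p (lie_bracket X Y p).

Definition extd2 (Phi : forall p, tangent p -> tangent p -> R) X Y Z p : R :=
  X p (fun q => Phi q (Y q) (Z q)) - Y p (fun q => Phi q (X q) (Z q))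
  + Z p (fun q => Phi q (X q) (Y q))
  - Phi p (lie_bracket X Y p) (Z p) + Phi p (lie_bracket X Z p) (Y p)
  - Phi p (lie_bracket Y Z p) (X p).

Definition closed_1form eta := forall U X Y p, open U -> U p ->
  smooth_vf U X -> smooth_vf U Y -> extd1 eta X Y p = 0.

Definition closed_2form Phi := forall U X Y Z p, open U -> U p ->
  smooth_vf U X -> smooth_vf U Y -> smooth_vf U Z -> extd2 Phi X Y Z p = 0.

Definition local_frame U (F : 'I_m -> vector_field M) :=
  (forall i, smooth_vf U (F i)) /\
  (forall q, U q -> forall v : tangent q,
     exists! c : 'rV[R]_m, v = \sum_i c 0 i *: F i q).

End TensorFields.

Section Connections.
Variables (R : realType) (m : nat) (M : smoothManifold R m).
Implicit Types (U : set M) (p q : M) (X Y Z : vector_field M).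
Implicit Types (E : forall p, tangent p -> Prop).
Implicit Types (g : forall p, tangent p -> tangent p -> R).
Implicit Types (D : forall p : M, tangent p -> vector_field M -> tangent p).

Definition smooth_section E U X :=
  smooth_vf U X /\ forall q, U q -> E q (X q).

(* D p v Y is the derivative of Y in the direction v at p, for v in the
   distribution E and Y a section of E near p. *)
Definition covariant D X Y : vector_field M := fun p => D p (X p) Y.

Record connection_along E D := {
  connection_linear : forall U p Y (a : R) (v w : tangent p), open U -> U p ->
    smooth_section E U Y -> E p v -> E p w ->
    D p (a *: v + w) Y = a *: D p v Y + D p w Y;
  connection_add : forall U p Y Z (v : tangent p), open U -> U p ->
    smooth_section E U Y -> smooth_section E U Z -> E p v ->
    D p v (fun q => Y q + Z q) = D p v Y + D p v Z;
  connection_leibniz : forall U p (f : M -> R) Y (v : tangent p), open U ->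
    U p -> smooth_on U f -> smooth_section E U Y -> E p v ->
    D p v (fun q => f q *: Y q) = v f *: Y p + f p *: D p v Y;
  connection_local : forall U p Y Z (v : tangent p), open U -> U p ->
    smooth_section E U Y -> (forall q, U q -> Y q = Z q) -> E p v ->
    D p v Y = D p v Z;
  connection_section : forall U X Y, open U -> smooth_section E U X ->
    smooth_section E U Y -> smooth_section E U (covariant D X Y) }.

(* The Levi-Civita connections of the metrics induced by g on the leaves of an
   integrable distribution E on which g is nondegenerate: vector fields on the
   leaves extend locally to sections of E, and the connections of all leaves
   together are the unique operator D of this kind. *)
Record levi_civita_along E g D := {
  levi_civita_connection : connection_along E D;
  levi_civita_torsion_free : forall U p X Y, open U -> U p ->
    smooth_section E U X -> smooth_section E U Y ->
    covariant D X Y p - covariant D Y X p = lie_bracket X Y p;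
  levi_civita_metric : forall U p X Y Z, open U -> U p ->
    smooth_section E U X -> smooth_section E U Y -> smooth_section E U Z ->
    X p (fun q => g q (Y q) (Z q)) =
      g p (covariant D X Y p) (Z p) + g p (Y p) (covariant D X Z p) }.

Definition levi_civita g D := levi_civita_along (fun _ _ => True) g D.

Definition curvature D X Y Z p : tangent p :=
  covariant D X (covariant D Y Z) p - covariant D Y (covariant D X Z) p
  - covariant D (lie_bracket X Y) Z p.

End Connections.

Section ParaContact.
Variables (R : realType) (m : nat) (M : smoothManifold R m).
Variables (phi : forall p : M, tangent p -> tangent p) (xi : vector_field M).
Variables (eta : forall p : M, tangent p -> R).
Variables (g : forall p : M, tangent p -> tangent p -> R).
Variables (nabla : forall p : M, tangent p -> vector_field M -> tangent p).
Implicit Types (U : set M) (p q : M) (X Y Z : vector_field M).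

Record almost_para_contact_metric := {
  para_contact_dim : odd m;
  para_contact_phi : smooth_endo phi;
  para_contact_xi : smooth_vf setT xi;
  para_contact_eta : smooth_1form setT eta;
  para_contact_g : pseudo_riemannian g;
  para_contact_phi2 : forall p (v : tangent p),
    phi (phi v) = v - eta v *: xi p;
  para_contact_eta_xi : forall p, eta (xi p) = 1;
  para_contact_compatible : forall p (v w : tangent p),
    g (phi v) (phi w) = - g v w + eta v * eta w;
  para_contact_dual : forall p (v : tangent p), eta v = g (xi p) v }.

Definition fundamental_form p (v w : tangent p) : R := g (phi v) w.

Definition almost_para_cosymplectic := [/\ almost_para_contact_metric,
  closed_1form eta & closed_2form fundamental_form].

Definition weakly_para_cosymplectic := almost_para_cosymplectic /\
  forall U p X Y Z, open U -> U p ->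
    smooth_vf U X -> smooth_vf U Y -> smooth_vf U Z ->
    curvature nabla X Y (fun q => phi (Z q)) p =
      phi (curvature nabla X Y Z p).

Definition shape_operator p (v : tangent p) : tangent p := - nabla v xi.

Definition leaf_tangent p (v : tangent p) : Prop := eta v = 0.

(* The leaves carry the structure (P, H) obtained by restricting phi and g, and
   P is parallel for their Levi-Civita connections. *)
Definition para_kahler_leaves :=
  exists2 D, levi_civita_along leaf_tangent g D &
    forall U p X Y, open U -> U p ->
      smooth_section leaf_tangent U X -> smooth_section leaf_tangent U Y ->
      covariant D X (fun q => phi (Y q)) p = phi (covariant D X Y p).

Record shape_pair U (eps sigma : R) (V1 V2 : vector_field M) := {
  shape_pair_smooth1 : smooth_vf U V1;
  shape_pair_smooth2 : smooth_vf U V2;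
  shape_pair_neq0 : forall q, U q -> V1 q <> 0 /\ V2 q <> 0;
  shape_pair_phi1 : forall q, U q -> phi (V1 q) = - V1 q;
  shape_pair_phi2 : forall q, U q -> phi (V2 q) = V2 q;
  shape_pair_orth : forall q, U q -> g (V1 q) (V2 q) = 0;
  shape_pairE : forall q (v : tangent q), U q ->
    shape_operator v = eps *: (g v (V1 q) *: V1 q + (sigma * g v (V2 q)) *: V2 q) }.

(* Elliptic type for sigma = 1, hyperbolic type for sigma = - 1. *)
Definition shape_type (eps sigma : R) := forall p, exists U V1 V2,
  [/\ open U, U p & shape_pair U eps sigma V1 V2].

End ParaContact.

Section AdoptedFrame.
Variables (R : realType) (M : smoothManifold R 5).
Variables (phi : forall p : M, tangent p -> tangent p) (xi : vector_field M).
Variables (g : forall p : M, tangent p -> tangent p -> R).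
Variables (nabla : forall p : M, tangent p -> vector_field M -> tangent p).

Definition frame5 (V1 V2 V3 V4 : vector_field M) (i : 'I_5) : vector_field M :=
  nth xi [:: xi; V1; V2; V3; V4] i.

Record adopted_frame U (sigma : R) V1 V2 V3 V4 := {
  adopted_frame_shape : shape_pair phi xi g nabla U 1 sigma V1 V2;
  adopted_frame_frame : local_frame U (frame5 V1 V2 V3 V4);
  adopted_frame_phi3 : forall q, U q -> phi (V3 q) = V3 q;
  adopted_frame_phi4 : forall q, U q -> phi (V4 q) = - V4 q;
  adopted_frame_metric : forall q (i j : 'I_5), U q ->
    g (frame5 V1 V2 V3 V4 i q) (frame5 V1 V2 V3 V4 j q) =
      (((i : nat), (j : nat)) \in
         [:: (0, 0); (1, 3); (3, 1); (2, 4); (4, 2)]%N)%:R }.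

End AdoptedFrame.

(* Main.v *)
Require Import Defs.
From mathcomp Require Import all_boot all_order all_algebra.
From mathcomp Require Import all_classical all_reals all_analysis.
From mathcomp Require Import ring lra.

Set Implicit Arguments.
Unset Strict Implicit.
Unset Printing Implicit Defensive.
Import Order.TTheory GRing.Theory Num.Theory numFieldNormedType.Exports.
Local Open Scope classical_set_scope.
Local Open Scope ring_scope.

(* Let (F_0, ..., F_4) = (xi, V1, V2, V3, V4) and G i j k = g(nabla_{F_i} F_j, F_k),
   which is skew in (j, k) because the Gram matrix of the frame is constant;
   G i 0 k is given by the shape operator. Since phi V1 = - V1 and
   phi V4 = - V4, one has G i 1 4 = 0: along the leaves, nabla agrees up to a
   multiple of xi with the Levi-Civita connection of the leaves (Koszul), which
   commutes with phi, and for i = 0 this is dPhi(xi, V1, V4) = 0. In the same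
   way G i 2 3 = 0. Finally phi R(X, Y) xi = R(X, Y) phi xi = 0, so that
   R(X, Y) xi is a multiple of xi; written out on the frame this is a linear
   system in the G i j k, which gives G i 1 2 = 0, G i 1 3 = 0 for i <> 3 and
   G i 2 4 = 0 for i <> 4. *)

Section ScalarForm.
Variables (R : realType) (V : lmodType R) (f : V -> R).
Hypothesis f_scalar : scalar f.

Lemma scalar_fct0 : f 0 = 0.
Proof. by have := f_scalar (-1) 0 0; rewrite scaler0 addr0 mulN1r addNr. Qed.

Lemma scalar_fctD v w : f (v + w) = f v + f w.
Proof. by rewrite -[v in LHS]scale1r f_scalar mul1r. Qed.

Lemma scalar_fctZ a v : f (a *: v) = a * f v.
Proof. by rewrite -[a *: v]addr0 f_scalar scalar_fct0 addr0. Qed.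

Lemma scalar_fctN v : f (- v) = - f v.
Proof. by rewrite -scaleN1r scalar_fctZ mulN1r. Qed.

Lemma scalar_fctB v w : f (v - w) = f v - f w.
Proof. by rewrite scalar_fctD scalar_fctN. Qed.

Lemma scalar_fct_sum n (c : 'rV[R]_n) (F : 'I_n -> V) :
  f (\sum_i c 0 i *: F i) = \sum_i c 0 i * f (F i).
Proof.
have -> : f (\sum_i c 0 i *: F i) = \sum_i f (c 0 i *: F i).
  by apply: (big_morph f scalar_fctD scalar_fct0).
by apply: eq_bigr => i _; rewrite scalar_fctZ.
Qed.
End ScalarForm.

Section Tangent.
Variables (R : realType) (m : nat) (M : smoothManifold R m).
Implicit Types (U W : set M) (p q : M) (X Y Z : vector_field M).

Lemma tangent_cst p (v : tangent p) (a : R) : v (fun=> a) = 0.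
Proof.
have /asboolP[v1 v2 _ _] := tangent_valP v.
have sm b : smooth_at p (fun=> b : R) by exact: smooth_at_cst.
have v_1 : v (fun=> 1) = 0.
  have := v2 _ _ (sm 1) (sm 1).
  rewrite (_ : (fun=> 1 * 1) = (fun=> 1)); last by apply/funext => q; rewrite mul1r.
  by move=> h; lra.
have v_0 : v (fun=> 0) = 0.
  have := v1 1 _ _ (sm 0) (sm 0).
  rewrite (_ : (fun=> 1 * 0 + 0) = (fun=> 0)); last first.
    by apply/funext => q; rewrite mulr0 addr0.
  by move=> h; lra.
have -> : (fun=> a) = (fun _ : M => a * 1 + 0) :> (M -> R).
  by apply/funext => q; rewrite mulr1 addr0.
by rewrite (v1 a _ _ (sm 1) (sm 0)) v_1 v_0 mulr0 addr0.
Qed.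

Lemma tangent_cst_on U p (v : tangent p) (f : M -> R) a : open U -> U p ->
  (forall q, U q -> f q = a) -> v f = 0.
Proof.
move=> oU Up fa; have /asboolP[_ _ v3 v4] := tangent_valP v.
have [sf|/v4//] := pselect (smooth_at p f).
rewrite (v3 f (fun=> a))//; [exact: tangent_cst|exact: smooth_at_cst|].
by apply: filterS (open_nbhs_nbhs (conj oU Up)) => q /fa.
Qed.

Lemma smooth_vfS U W X : W `<=` U -> smooth_vf U X -> smooth_vf W X.
Proof. by move=> WU sX O f oO OW; apply: sX => // q /OW /WU. Qed.

End Tangent.

Section Metric.
Variables (R : realType) (m : nat) (M : smoothManifold R m).
Variable g : forall p : M, tangent p -> tangent p -> R.
Hypothesis hg : pseudo_riemannian g.

Lemma metric_linearr p (v : tangent p) : scalar (g v).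
Proof. by move=> a w z; rewrite !(Defs.metric_sym hg v) (metric_linear hg). Qed.

Definition metricDl p (w : tangent p) := scalar_fctD (metric_linear hg w).
Definition metricZl p (w : tangent p) := scalar_fctZ (metric_linear hg w).
Definition metricNl p (w : tangent p) := scalar_fctN (metric_linear hg w).
Definition metricBl p (w : tangent p) := scalar_fctB (metric_linear hg w).
Definition metric0l p (w : tangent p) := scalar_fct0 (metric_linear hg w).
Definition metricZr p (v : tangent p) := scalar_fctZ (metric_linearr v).
Definition metricDr p (v : tangent p) := scalar_fctD (metric_linearr v).

Lemma metric_inj p (v w : tangent p) : (forall z, g v z = g w z) -> v = w.
Proof.
move=> vw; apply/eqP; rewrite -subr_eq0; apply/eqP.
by apply: (metric_nondegenerate hg) => z; rewrite metricBl vw subrr.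
Qed.

Section Koszul.
Variables (E : forall p : M, tangent p -> Prop).
Variables (D : forall p : M, tangent p -> vector_field M -> tangent p).
Hypothesis hD : levi_civita_along E g D.

Lemma levi_civita_koszul U p X Y Z : open U -> U p -> smooth_section E U X ->
  smooth_section E U Y -> smooth_section E U Z ->
  2 * g (covariant D X Y p) (Z p) =
    X p (fun q => g (Y q) (Z q)) + Y p (fun q => g (Z q) (X q))
    - Z p (fun q => g (X q) (Y q)) + g (lie_bracket X Y p) (Z p)
    - g (lie_bracket Y Z p) (X p) - g (lie_bracket X Z p) (Y p).
Proof.
move=> oU Up sX sY sZ.
rewrite !(levi_civita_metric hD oU Up)//.
rewrite -!(levi_civita_torsion_free hD oU Up)// !metricBl.
rewrite !(Defs.metric_sym hg (X p)) !(Defs.metric_sym hg (Y p)).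
rewrite !(Defs.metric_sym hg (Z p)).
by ring.
Qed.
End Koszul.

Section LeviCivita.
Variables (nabla : forall p : M, tangent p -> vector_field M -> tangent p).
Hypothesis hnabla : levi_civita g nabla.

Lemma levi_civita_restrict E D U p X Y Z : levi_civita_along E g D ->
  open U -> U p -> smooth_section E U X -> smooth_section E U Y ->
  smooth_section E U Z ->
  g (covariant D X Y p) (Z p) = g (covariant nabla X Y p) (Z p).
Proof.
move=> hD oU Up sX sY sZ.
have sT W : smooth_section E U W -> smooth_section (fun _ _ => True) U W.
  by case.
have := levi_civita_koszul hD oU Up sX sY sZ.
rewrite -(levi_civita_koszul hnabla oU Up (sT _ sX) (sT _ sY) (sT _ sZ)).
by apply: mulfI; rewrite pnatr_eq0.
Qed.

Lemma levi_civita_linear U p Y : open U -> U p -> smooth_vf U Y ->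
  linear (fun v : tangent p => nabla v Y).
Proof.
move=> oU Up sY a v w.
by apply: (connection_linear (levi_civita_connection hnabla) _ oU Up).
Qed.

Lemma levi_civita_smooth U X Y : open U -> smooth_vf U X -> smooth_vf U Y ->
  smooth_vf U (covariant nabla X Y).
Proof.
move=> oU sX sY; have hc := levi_civita_connection hnabla.
by have [] := connection_section hc oU (conj sX (fun _ _ => I))
  (conj sY (fun _ _ => I)).
Qed.

Lemma levi_civita_bracket U p X Y : open U -> U p -> smooth_vf U X ->
  smooth_vf U Y ->
  lie_bracket X Y p = covariant nabla X Y p - covariant nabla Y X p.
Proof.
by move=> oU Up sX sY; rewrite (levi_civita_torsion_free hnabla oU Up).
Qed.

Lemma levi_civita_product U p X Y Z : open U -> U p -> smooth_vf U X ->
  smooth_vf U Y -> smooth_vf U Z ->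
  X p (fun q => g (Y q) (Z q)) =
    g (covariant nabla X Y p) (Z p) + g (covariant nabla X Z p) (Y p).
Proof.
by move=> oU Up sX sY sZ;
  rewrite (levi_civita_metric hnabla oU Up)// [g (Y p) _](Defs.metric_sym hg).
Qed.

Lemma levi_civita_skew U p X Y Z a : open U -> U p -> smooth_vf U X ->
  smooth_vf U Y -> smooth_vf U Z -> (forall q, U q -> g (Y q) (Z q) = a) ->
  g (covariant nabla X Y p) (Z p) = - g (covariant nabla X Z p) (Y p).
Proof.
move=> oU Up sX sY sZ YZ; apply/eqP; rewrite -addr_eq0.
by rewrite -(levi_civita_product oU Up)// (tangent_cst_on _ oU Up YZ).
Qed.

Lemma levi_civita0 X : covariant nabla X (fun=> 0) = (fun=> 0).
Proof.
apply: functional_extensionality_dep => p; rewrite /covariant.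
have hc := levi_civita_connection hnabla.
have s0 : smooth_vf [set: M] (fun=> 0).
  move=> W f oW _ _; rewrite (_ : (fun _ => _) = fun=> 0)//.
  exact: smooth_on_cst.
have lz := connection_leibniz hc (openT : open [set: M]).
have := lz p (fun=> 0) (fun=> 0) (X p) I (smooth_on_cst 0 openT)
  (conj s0 (fun _ _ => I)) I.
rewrite scaler0 !scale0r addr0 => lz0; rewrite -[RHS]lz0; congr (nabla _).
by apply: functional_extensionality_dep => q; rewrite scaler0.
Qed.

End LeviCivita.
End Metric.

Section ParaContact.
Variables (R : realType) (m : nat) (M : smoothManifold R m).
Variables (phi : forall p : M, tangent p -> tangent p) (xi : vector_field M).
Variables (eta : forall p : M, tangent p -> R).
Variables (g : forall p : M, tangent p -> tangent p -> R).
Hypothesis H : almost_para_contact_metric phi xi eta g.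

Let hg := para_contact_g H.

Lemma para_contact_phi_lin p : linear (@phi p).
Proof. by case: (para_contact_phi H). Qed.

Lemma para_contact_phi0 p : @phi p 0 = 0.
Proof.
by have := para_contact_phi_lin (-1) (0 : tangent p) 0;
  rewrite scaler0 addr0 scaleN1r addNr.
Qed.

Lemma para_contact_phiZ p a (v : tangent p) : phi (a *: v) = a *: phi v.
Proof.
by rewrite -[a *: v]addr0 para_contact_phi_lin para_contact_phi0 addr0.
Qed.

Lemma para_contact_xi_neq0 p : xi p != 0.
Proof.
apply/negP => /eqP xi0; have /eqP := para_contact_eta_xi H p.
by rewrite (para_contact_dual H) xi0 (metric0l hg) eq_sym oner_eq0.
Qed.

Lemma para_contact_phi_xi p : phi (xi p) = 0.
Proof.
have phi2xi : phi (phi (xi p)) = 0.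
  by rewrite (para_contact_phi2 H) (para_contact_eta_xi H) scale1r subrr.
have phixiE : phi (xi p) = g (phi (xi p)) (xi p) *: xi p.
  apply: (metric_inj hg) => w; rewrite (metricZl hg).
  have := para_contact_compatible H (xi p) (phi w).
  rewrite (para_contact_phi2 H) -scaleNr (metricDr hg) (metricZr hg).
  rewrite (para_contact_eta_xi H) mul1r !(para_contact_dual H) addNr.
  by move=> /eqP; rewrite mulNr subr_eq0 mulrC => /eqP.
move: phi2xi; rewrite phixiE para_contact_phiZ {2}phixiE scalerA => /eqP.
rewrite scaler_eq0 (negPf (para_contact_xi_neq0 p)) orbF mulf_eq0 orbb.
by move=> /eqP->; rewrite scale0r.
Qed.

Lemma para_contact_eta_phi p (v : tangent p) : eta (phi v) = 0.
Proof.
have : phi (phi (phi v)) = phi v.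
  rewrite (para_contact_phi2 H v) addrC -scaleNr para_contact_phi_lin.
  by rewrite para_contact_phi_xi scaler0 add0r.
rewrite (para_contact_phi2 H) => /eqP.
rewrite -subr_eq0 addrC addKr oppr_eq0 scaler_eq0.
by rewrite (negPf (para_contact_xi_neq0 p)) orbF => /eqP.
Qed.

Lemma para_contact_phi_skew p (v w : tangent p) : g (phi v) w = - g v (phi w).
Proof.
have := para_contact_compatible H v (phi w).
rewrite (para_contact_phi2 H) -scaleNr (metricDr hg) (metricZr hg).
rewrite para_contact_eta_phi mulr0 addr0.
rewrite [g (phi v) (xi p)](Defs.metric_sym hg) -(para_contact_dual H).
by rewrite para_contact_eta_phi mulr0 addr0.
Qed.

Lemma fundamental_form_eigen p s (v w : tangent p) : phi w = s *: w ->
  fundamental_form phi g v w = - (s * g v w).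
Proof.
by move=> phiw; rewrite /fundamental_form para_contact_phi_skew phiw (metricZr hg).
Qed.

Section Nabla.
Variables (nabla : forall p : M, tangent p -> vector_field M -> tangent p).
Hypothesis hnabla : levi_civita g nabla.

Lemma para_kahler_eigen U p s X Y Z : para_kahler_leaves phi eta g -> s != 0 ->
  open U -> U p -> smooth_section (leaf_tangent eta) U X ->
  smooth_section (leaf_tangent eta) U Y ->
  smooth_section (leaf_tangent eta) U Z ->
  (forall q, U q -> phi (Y q) = s *: Y q) -> phi (Z p) = s *: Z p ->
  g (covariant nabla X Y p) (Z p) = 0.
Proof.
move=> [D hD Dphi] s0 oU Up sX sY sZ phiY phiZ.
rewrite -(levi_civita_restrict hg hnabla hD oU Up sX sY sZ).
have hc := levi_civita_connection hD.
have DphiY : phi (covariant D X Y p) = s *: covariant D X Y p.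
  rewrite -(Dphi U p X Y oU Up sX sY) /covariant.
  have [_ /(_ p Up) Xp] := sX.
  have sphiY : smooth_section (leaf_tangent eta) U (fun q => phi (Y q)).
    split=> [|q _]; last exact: para_contact_eta_phi.
    by have [_ sphi] := para_contact_phi H; apply: sphi oU (proj1 sY).
  rewrite (connection_local hc oU Up sphiY phiY Xp).
  rewrite (connection_leibniz hc oU Up (f := fun=> s))//; last exact: smooth_on_cst.
  by rewrite tangent_cst scale0r add0r.
have := para_contact_phi_skew (covariant D X Y p) (Z p).
rewrite DphiY phiZ (metricZl hg) (metricZr hg) => h.
have /eqP : s * g (covariant D X Y p) (Z p) = 0 by lra.
by rewrite mulf_eq0 (negPf s0) /= => /eqP.
Qed.

Lemma closed_fundamental_form_eigen U p s Y Z :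
  closed_2form (fundamental_form phi g) -> s != 0 -> open U -> U p ->
  smooth_vf U Y -> smooth_vf U Z -> (forall q, U q -> g (Y q) (Z q) = 0) ->
  (forall q, U q -> phi (Y q) = s *: Y q) ->
  (forall q, U q -> phi (Z q) = s *: Z q) ->
  g (covariant nabla Y xi p) (Z p) = g (covariant nabla Z xi p) (Y p) ->
  g (covariant nabla xi Y p) (Z p) = 0.
Proof.
move=> hPhi s0 oU Up sY sZ YZ phiY phiZ symA.
have sxi : smooth_vf U xi by apply: smooth_vfS (para_contact_xi H).
have := hPhi U xi Y Z p oU Up sxi sY sZ.
have Phi_xi q (v : tangent q) : fundamental_form phi g v (xi q) = 0.
  by rewrite /fundamental_form [g _ _](Defs.metric_sym hg) -(para_contact_dual H)
    para_contact_eta_phi.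
have xi_Phi q (v : tangent q) : fundamental_form phi g (xi q) v = 0.
  by rewrite /fundamental_form para_contact_phi_xi (metric0l hg).
rewrite /extd2 Phi_xi !(fundamental_form_eigen _ (phiY p Up)).
rewrite !(fundamental_form_eigen _ (phiZ p Up)).
have YZ0 q : U q -> fundamental_form phi g (Y q) (Z q) = 0.
  by move=> Uq; rewrite (fundamental_form_eigen _ (phiZ q Uq)) YZ// mulr0 oppr0.
rewrite (tangent_cst_on _ oU Up YZ0).
rewrite !(tangent_cst_on _ oU Up (fun q _ => xi_Phi q _)).
rewrite !(levi_civita_bracket hnabla oU Up)// !(metricBl hg) symA.
rewrite (levi_civita_skew hg hnabla oU Up sxi sZ sY (a := 0)); last first.
  by move=> q Uq; rewrite (Defs.metric_sym hg) YZ.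
move=> h.
have /eqP : s * g (covariant nabla xi Y p) (Z p) = 0 by lra.
by rewrite mulf_eq0 (negPf s0) /= => /eqP.
Qed.

Lemma curvature_xi_leaf U p X Y (v : tangent p) :
  weakly_para_cosymplectic phi xi eta g nabla -> open U -> U p ->
  smooth_vf U X -> smooth_vf U Y -> eta v = 0 ->
  g (curvature nabla X Y xi p) v = 0.
Proof.
move=> [_ hR] oU Up sX sY etav.
have sxi : smooth_vf U xi by apply: smooth_vfS (para_contact_xi H).
have := hR U p X Y xi oU Up sX sY sxi.
have -> : (fun q => phi (xi q)) = (fun=> 0).
  by apply: functional_extensionality_dep => q; exact: para_contact_phi_xi.
rewrite {1}/curvature !(levi_civita0 hnabla) !subr0 => phiR0.
have := para_contact_phi2 H (curvature nabla X Y xi p).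
rewrite -phiR0 para_contact_phi0 => /esym/eqP; rewrite subr_eq0 => /eqP ->.
by rewrite (metricZl hg) -(para_contact_dual H) etav mulr0.
Qed.

(* Expanding [R(X, Y) xi] against [Z] produces no second covariant derivative,
   because the functions differentiated are constant. *)
Lemma codazzi_constant U p X Y Z a b :
  weakly_para_cosymplectic phi xi eta g nabla -> open U -> U p ->
  smooth_vf U X -> smooth_vf U Y -> smooth_vf U Z -> eta (Z p) = 0 ->
  (forall q, U q -> g (covariant nabla X xi q) (Z q) = a) ->
  (forall q, U q -> g (covariant nabla Y xi q) (Z q) = b) ->
  g (covariant nabla X xi p) (covariant nabla Y Z p)
  - g (covariant nabla Y xi p) (covariant nabla X Z p)
  = g (nabla (covariant nabla X Y p) xi) (Z p)
    - g (nabla (covariant nabla Y X p) xi) (Z p).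
Proof.
move=> hw oU Up sX sY sZ etaZ Xa Yb.
have sxi : smooth_vf U xi by apply: smooth_vfS (para_contact_xi H).
have snX := levi_civita_smooth hnabla oU sX sxi.
have snY := levi_civita_smooth hnabla oU sY sxi.
have := curvature_xi_leaf hw oU Up sX sY etaZ.
rewrite /curvature !(metricBl hg).
rewrite (levi_civita_skew hg hnabla oU Up sX snY sZ Yb).
rewrite (levi_civita_skew hg hnabla oU Up sY snX sZ Xa).
rewrite [covariant nabla (lie_bracket X Y) xi p]/covariant.
rewrite (levi_civita_bracket hnabla oU Up sX sY).
have nlin := levi_civita_linear hnabla oU Up sxi.
have -> (v w : tangent p) : nabla (v - w) xi = nabla v xi - nabla w xi.
  by rewrite -scaleN1r addrC nlin scaleN1r addrC.
rewrite (metricBl hg).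
rewrite ![g (covariant nabla _ _ p) (covariant nabla _ xi p)](Defs.metric_sym hg).
by move=> h; lra.
Qed.

End Nabla.
End ParaContact.

Local Notation o0 := (@Ordinal 5 0 isT).
Local Notation o1 := (@Ordinal 5 1 isT).
Local Notation o2 := (@Ordinal 5 2 isT).
Local Notation o3 := (@Ordinal 5 3 isT).
Local Notation o4 := (@Ordinal 5 4 isT).

Lemma ord5_ind (P : 'I_5 -> Prop) :
  P o0 -> P o1 -> P o2 -> P o3 -> P o4 -> forall i, P i.
Proof.
move=> P0 P1 P2 P3 P4 [[|[|[|[|[|//]]]]] i5];
  by rewrite (bool_irrelevance i5 isT).
Qed.

Definition adopted_gram (R : realType) (i j : 'I_5) : R :=
  (((i : nat), (j : nat)) \in
     [:: (0, 0); (1, 3); (3, 1); (2, 4); (4, 2)]%N)%:R.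

Lemma adopted_codazzi_solve (R : realType) (sigma : R)
    (G : 'I_5 -> 'I_5 -> 'I_5 -> R) : sigma = 1 \/ sigma = - 1 ->
  let d := @adopted_gram R in
  (forall i j k, G i j k = - G i k j) ->
  (forall i k, G i o0 k = - (d i o1 * d k o1) - sigma * d i o2 * d k o2) ->
  (forall i, G i o1 o4 = 0) -> (forall i, G i o2 o3 = 0) ->
  (forall i j k, k != o0 ->
    d i o1 * G j k o1 + sigma * d i o2 * G j k o2
    - (d j o1 * G i k o1 + sigma * d j o2 * G i k o2) =
    d k o1 * (G i j o1 - G j i o1) + sigma * d k o2 * (G i j o2 - G j i o2)) ->
  [/\ forall i, G i o1 o2 = 0,
      forall i, G i o1 o3 = d i o1 * G o3 o1 o3
    & forall i, G i o2 o4 = d i o2 * G o4 o2 o4].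
Proof.
move=> hs d skew G0 G14 G23 cod.
have G11 i j : G i j j = 0 by have := skew i j j; lra.
rewrite /d /adopted_gram in cod G0 *.
have G12 i : G i o1 o2 = 0.
  have := cod i o3 o2 isT; have := cod i o4 o1 isT.
  rewrite !(skew _ o2 o1) !G11.
  by elim/ord5_ind: i => /=; case: hs => ->; lra.
split=> //.
- elim/ord5_ind.
  + have := cod o0 o3 o3 isT; rewrite /= (skew o0 o3 o1) !G0 /=; lra.
  + have := cod o1 o3 o3 isT; rewrite /= (skew o1 o3 o1) !G11 /=; lra.
  + have := cod o2 o3 o3 isT; rewrite /= (skew o2 o3 o1) (skew o3 o2 o1) G12 /=; lra.
  + by rewrite /= mul1r.
  + have := cod o4 o3 o3 isT.
    rewrite /= (skew o4 o3) (skew o3 o3 o2) (skew o3 o4 o1) G14 G23; lra.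
- elim/ord5_ind.
  + have := cod o0 o4 o4 isT; rewrite /= (skew o0 o4 o2) !G0 /=.
    case: hs => ->; lra.
  + have := cod o1 o4 o4 isT; rewrite /= (skew o1 o4 o2) G12 /=; case: hs => ->; lra.
  + have := cod o2 o4 o4 isT; rewrite /= (skew o2 o4 o2) !G11 /=.
    case: hs => ->; lra.
  + have := cod o3 o4 o4 isT.
    rewrite /= (skew o3 o4 o2) (skew o4 o4 o1) (skew o4 o3 o2) G14 G23.
    case: hs => ->; lra.
  + by rewrite /= mul1r.
Qed.

Section AdoptedFrame.
Variables (R : realType) (M : smoothManifold R 5).
Variables (phi : forall p : M, tangent p -> tangent p) (xi : vector_field M).
Variables (eta : forall p : M, tangent p -> R).
Variables (g : forall p : M, tangent p -> tangent p -> R).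
Variables (nabla : forall p : M, tangent p -> vector_field M -> tangent p).
Variables (sigma : R) (U : set M) (V1 V2 V3 V4 : vector_field M).
Hypothesis hsigma : sigma = 1 \/ sigma = - 1.
Hypothesis hnabla : levi_civita g nabla.
Hypothesis hweak : weakly_para_cosymplectic phi xi eta g nabla.
Hypothesis hleaves : para_kahler_leaves phi eta g.
Hypothesis hU : open U.
Hypothesis hframe : adopted_frame phi xi g nabla U sigma V1 V2 V3 V4.

Local Notation F := (frame5 xi V1 V2 V3 V4).
Local Notation d := (adopted_gram R).

Let H : almost_para_contact_metric phi xi eta g.
Proof. by case: hweak => -[]. Qed.

Let hg := para_contact_g H.

Lemma adopted_frame_smooth i : smooth_vf U (F i).
Proof. by case: (adopted_frame_frame hframe). Qed.

Lemma adopted_frame_gram q i j : U q -> g (F i q) (F j q) = d i j.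
Proof. exact: adopted_frame_metric hframe q i j. Qed.

Lemma adopted_frame_scalar_ext q (f h : tangent q -> R) : U q ->
  scalar f -> scalar h -> (forall i, f (F i q) = h (F i q)) -> forall v, f v = h v.
Proof.
move=> Uq lf lh fh v; have [_ /(_ q Uq v)[c [-> _]]] := adopted_frame_frame hframe.
rewrite (scalar_fct_sum lf) (scalar_fct_sum lh).
by apply: eq_bigr => i _; rewrite fh.
Qed.

Lemma adopted_frame_inj q (v w : tangent q) : U q ->
  (forall i, g v (F i q) = g w (F i q)) -> v = w.
Proof.
move=> Uq vw; apply: (metric_inj hg).
by apply: adopted_frame_scalar_ext Uq _ _ vw; exact: metric_linearr.
Qed.

Lemma adopted_frame_nabla_xi q (v : tangent q) : U q ->
  nabla v xi = - (g v (V1 q) *: V1 q) - (sigma * g v (V2 q)) *: V2 q.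
Proof.
move=> Uq; have := shape_pairE (adopted_frame_shape hframe) v Uq.
by rewrite /shape_operator scale1r => /(congr1 -%R); rewrite opprK opprD.
Qed.

Definition adopted_connection q (v : tangent q) j k : R :=
  g (nabla v (F j)) (F k q).

Local Notation n := adopted_connection.

Lemma adopted_connection_scalar q j k : U q -> scalar (fun v : tangent q => n v j k).
Proof.
move=> Uq a v w; rewrite /adopted_connection.
rewrite (levi_civita_linear hnabla hU Uq (@adopted_frame_smooth j)).
by rewrite (metric_linear hg).
Qed.

Lemma scalar_metric_mul q (a : R) (w : tangent q) : scalar (fun v => a * g v w).
Proof. by move=> b v z; rewrite (metric_linear hg) mulrDr mulrCA. Qed.

Lemma adopted_connection_skew q (v : tangent q) j k : U q -> n v j k = - n v k j.
Proof.
move=> Uq; move: v; apply: adopted_frame_scalar_ext => // [||i].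
- exact: adopted_connection_scalar.
- by move=> a v w; rewrite adopted_connection_scalar// opprD mulrN.
- apply: (levi_civita_skew hg hnabla hU Uq); try exact: adopted_frame_smooth.
  by move=> r Ur; apply: adopted_frame_gram.
Qed.

Lemma nabla_xi_metric q (v w : tangent q) : U q ->
  g (nabla v xi) w =
    - (g v (F o1 q) * g w (F o1 q)) - sigma * g v (F o2 q) * g w (F o2 q).
Proof.
move=> Uq; rewrite adopted_frame_nabla_xi// (metricBl hg) (metricNl hg).
by rewrite !(metricZl hg) ![g w _](Defs.metric_sym hg).
Qed.

Lemma adopted_connection0 q (v : tangent q) k : U q ->
  n v o0 k = - (g v (F o1 q) * d k o1) - sigma * g v (F o2 q) * d k o2.
Proof.
by move=> Uq; rewrite /adopted_connection nabla_xi_metric// !adopted_frame_gram.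
Qed.

Lemma adopted_frame_leaf i : i != o0 -> smooth_section (leaf_tangent eta) U (F i).
Proof.
move=> i0; split=> [|q Uq]; first exact: adopted_frame_smooth.
rewrite /leaf_tangent (para_contact_dual H).
transitivity (d o0 i); first exact: adopted_frame_gram q o0 i Uq.
by elim/ord5_ind: i i0.
Qed.

Lemma adopted_connection_eigen q i j k s : U q -> s != 0 ->
  j != o0 -> k != o0 -> d j k = 0 ->
  (forall r, U r -> phi (F j r) = s *: F j r) ->
  (forall r, U r -> phi (F k r) = s *: F k r) -> n (F i q) j k = 0.
Proof.
move=> Uq s0 j0 k0 djk phij phik.
have [->|i0] := eqVneq i o0.
  apply: (closed_fundamental_form_eigen H hnabla _ s0 hU Uq) phij phik _.
  - by case: hweak => -[].
  - exact: adopted_frame_smooth.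
  - exact: adopted_frame_smooth.
  - by move=> r Ur; rewrite adopted_frame_gram.
  - by rewrite /covariant !nabla_xi_metric//; ring.
by apply: (para_kahler_eigen H hnabla hleaves s0 hU Uq) (phik q Uq) => //;
  exact: adopted_frame_leaf.
Qed.

Lemma adopted_connection14 q i : U q -> n (F i q) o1 o4 = 0.
Proof.
move=> Uq; apply: (@adopted_connection_eigen q i o1 o4 (-1)) => //.
- move=> r Ur; rewrite scaleN1r.
  exact: shape_pair_phi1 (adopted_frame_shape hframe) _ Ur.
- by move=> r Ur; rewrite scaleN1r; exact: adopted_frame_phi4 hframe _ Ur.
Qed.

Lemma adopted_connection23 q i : U q -> n (F i q) o2 o3 = 0.
Proof.
move=> Uq; apply: (@adopted_connection_eigen q i o2 o3 1) => //.
- move=> r Ur; rewrite scale1r.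
  exact: shape_pair_phi2 (adopted_frame_shape hframe) _ Ur.
- by move=> r Ur; rewrite scale1r; exact: adopted_frame_phi3 hframe _ Ur.
Qed.

Lemma adopted_connection_codazzi q i j k : U q -> k != o0 ->
  d i o1 * n (F j q) k o1 + sigma * d i o2 * n (F j q) k o2
    - (d j o1 * n (F i q) k o1 + sigma * d j o2 * n (F i q) k o2) =
  d k o1 * (n (F i q) j o1 - n (F j q) i o1)
    + sigma * d k o2 * (n (F i q) j o2 - n (F j q) i o2).
Proof.
move=> Uq k0; have nxi i' r : U r -> g (covariant nabla (F i') xi r) (F k r) =
    - (d i' o1 * d k o1) - sigma * d i' o2 * d k o2.
  by move=> Ur; rewrite /covariant nabla_xi_metric// !adopted_frame_gram.
have := codazzi_constant H hnabla hweak hU Uq (@adopted_frame_smooth i)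
  (@adopted_frame_smooth j) (@adopted_frame_smooth k)
  (proj2 (adopted_frame_leaf k0) q Uq) (nxi i) (nxi j).
rewrite {1 3}/covariant !nabla_xi_metric// !adopted_frame_gram//.
by rewrite /adopted_connection /covariant; lra.
Qed.

Lemma adopted_connection_solve q : U q ->
  [/\ forall v : tangent q, n v o1 o2 = 0,
      forall v : tangent q, n v o1 o4 = 0,
      forall v : tangent q, n v o2 o3 = 0,
      forall v : tangent q, n v o1 o3 = n (F o3 q) o1 o3 * g v (F o1 q)
    & forall v : tangent q, n v o2 o4 = n (F o4 q) o2 o4 * g v (F o2 q)].
Proof.
move=> Uq.
have ext j k a (w : tangent q) : (forall i, n (F i q) j k = a * g (F i q) w) ->
    forall v : tangent q, n v j k = a * g v w.
  apply: adopted_frame_scalar_ext => //; first exact: adopted_connection_scalar.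
  exact: scalar_metric_mul.
have ext0 j k : (forall i, n (F i q) j k = 0) -> forall v : tangent q, n v j k = 0.
  move=> n0 v; rewrite (ext j k 0 (F j q)) ?mul0r// => i.
  by rewrite n0 mul0r.
have G0 i k : n (F i q) o0 k = - (d i o1 * d k o1) - sigma * d i o2 * d k o2.
  by rewrite adopted_connection0// !adopted_frame_gram.
have [G12 G13 G24] := adopted_codazzi_solve hsigma
  (fun i j k => adopted_connection_skew (F i q) j k Uq) G0
  (fun i => adopted_connection14 i Uq) (fun i => adopted_connection23 i Uq)
  (fun i j k => @adopted_connection_codazzi q i j k Uq).
split; try (apply: ext0 => // i).
- exact: adopted_connection14.
- exact: adopted_connection23.
- by apply: ext => i; rewrite adopted_frame_gram// mulrC; exact: G13.
- by apply: ext => i; rewrite adopted_frame_gram// mulrC; exact: G24.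
Qed.

Lemma adopted_connection_smooth j k :
  smooth_1form U (fun q (v : tangent q) => n v j k).
Proof.
split=> [q Uq|W X oW WU sX]; first exact: adopted_connection_scalar.
have sF i : smooth_vf W (F i) := smooth_vfS WU (@adopted_frame_smooth i).
exact: (metric_smooth hg oW (levi_civita_smooth hnabla oW sX (sF j)) (sF k)).
Qed.
End AdoptedFrame.

Theorem proposition4 (R : realType) (M : smoothManifold R 5)
  (phi : forall p : M, tangent p -> tangent p) (xi : vector_field M)
  (eta : forall p : M, tangent p -> R)
  (g : forall p : M, tangent p -> tangent p -> R)
  (nabla : forall p : M, tangent p -> vector_field M -> tangent p)
  (sigma : R) (hsigma : sigma = 1 \/ sigma = - 1)
  (hnabla : levi_civita g nabla)
  (hweak : weakly_para_cosymplectic phi xi eta g nabla)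
  (hleaves : para_kahler_leaves phi eta g)
  (htype : shape_type phi xi g nabla 1 sigma)
  (p : M) (U : set M) (hU : open U) (hp : U p)
  (V1 V2 V3 V4 : vector_field M)
  (hframe : adopted_frame phi xi g nabla U sigma V1 V2 V3 V4) :
  exists (tau1 tau2 omega : forall q : M, tangent q -> R)
         (alpha1 alpha2 : M -> R),
    [/\ smooth_1form U tau1, smooth_1form U tau2 & smooth_1form U omega] /\
    smooth_on U alpha1 /\ smooth_on U alpha2 /\
    forall X : vector_field M, smooth_vf U X -> forall q : M, U q ->
      (nabla q (X q) xi = - shape_operator xi nabla (X q) /\
       - shape_operator xi nabla (X q) =
         - (g q (X q) (V1 q) *: V1 q)
         - (sigma * g q (X q) (V2 q)) *: V2 q) /\
      (nabla q (X q) V1 = tau1 q (X q) *: V1 q /\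
       tau1 q (X q) = alpha1 q * g q (X q) (V1 q)) /\
      (nabla q (X q) V2 = tau2 q (X q) *: V2 q /\
       tau2 q (X q) = alpha2 q * g q (X q) (V2 q)) /\
      nabla q (X q) V3 =
        g q (X q) (V1 q) *: xi q + omega q (X q) *: V2 q
        - tau1 q (X q) *: V3 q /\
      nabla q (X q) V4 =
        (sigma * g q (X q) (V2 q)) *: xi q - omega q (X q) *: V1 q
        - tau2 q (X q) *: V4 q.
Proof.
have [[H _ _] _] := hweak.
have hg := para_contact_g H.
pose F := frame5 xi V1 V2 V3 V4.
pose n q (v : tangent q) j k := adopted_connection xi g nabla V1 V2 V3 V4 v j k.
have sn := adopted_connection_smooth hnabla hweak hU hframe.
have sF := adopted_frame_smooth hframe.
exists (fun q v => n q v o1 o3), (fun q v => n q v o2 o4), (fun q v => n q v o3 o4).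
exists (fun q => n q (F o3 q) o1 o3), (fun q => n q (F o4 q) o2 o4).
split; first by split; exact: sn.
split; first by apply: (proj2 (sn o1 o3)) => //; exact: sF.
split; first by apply: (proj2 (sn o2 o4)) => //; exact: sF.
move=> X _ q Uq; move: (X q) => v {X}.
have [n12 n14 n23 n13 n24] :=
  adopted_connection_solve hsigma hnabla hweak hleaves hU hframe Uq.
have skew := adopted_connection_skew hnabla hweak hU hframe.
have n0 := adopted_connection0 hweak hframe v _ Uq.
have njj j : n q v j j = 0 by have := skew q v j j Uq; rewrite /n; lra.
have gram i j := adopted_frame_gram hframe i j Uq.
have inj := adopted_frame_inj hweak hframe Uq.
have n1 k : n q v o1 k = n q v o1 o3 * adopted_gram R o1 k.
  elim/ord5_ind: k; rewrite /adopted_gram /= ?mulr1 ?mulr0 ?njj//;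
    try exact: n12; try exact: n14.
  by rewrite /n skew// n0 /adopted_gram /=; ring.
have n2 k : n q v o2 k = n q v o2 o4 * adopted_gram R o2 k.
  elim/ord5_ind: k; rewrite /adopted_gram /= ?mulr1 ?mulr0 ?njj//; try exact: n23.
    by rewrite /n skew// n0 /adopted_gram /=; ring.
  by rewrite /n skew// n12 oppr0.
split; first by rewrite /shape_operator opprK (adopted_frame_nabla_xi hframe).
split.
  split; last exact: n13.
  by apply: inj => k; rewrite (metricZl hg) (gram o1 k); exact: n1.
split.
  split; last exact: n24.
  by apply: inj => k; rewrite (metricZl hg) (gram o2 k); exact: n2.
split; apply: inj => k.
  rewrite (metricBl hg) (metricDl hg) !(metricZl hg).
  rewrite (gram o0 k) (gram o2 k) (gram o3 k) -[LHS]/(n q v o3 k).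
  elim/ord5_ind: k; rewrite /adopted_gram /= ?mulr1 ?mulr0 ?njj;
    rewrite ?addr0 ?subr0 ?add0r ?sub0r//.
  - by rewrite /n skew// n0 /adopted_gram /=; ring.
  - by rewrite /n skew.
  - by rewrite /n skew// n23 oppr0.
rewrite (metricBl hg) (metricBl hg) !(metricZl hg).
rewrite (gram o0 k) (gram o1 k) (gram o4 k) -[LHS]/(n q v o4 k).
elim/ord5_ind: k; rewrite /adopted_gram /= ?mulr1 ?mulr0 ?njj;
    rewrite ?addr0 ?subr0 ?add0r ?sub0r//.
- by rewrite /n skew// n0 /adopted_gram /=; ring.
- by rewrite /n skew// n14 oppr0.
- by rewrite /n skew.
- by rewrite /n skew.
Qed.
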